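(* Let $\Phi\colon\mathbb{R}^n\rightrightarrows\mathbb{R}^m$ be a set-valued mapping with closed graph and let $\bar x\in M:=\{x\in\mathbb{R}^n\mid 0\in\Phi(x)\}$ be such that $\Phi$ is metrically regular at $(\bar x,0)$. Then $\bar x$ is AM-regular.
   Context: Metric regularity: $\Phi$ is metrically regular at $(\bar x,\bar y)\in\operatorname{gph}\Phi:=\{(x,y)\mid y\in\Phi(x)\}$ if there are neighborhoods $U$ of $\bar x$ and $V$ of $\bar y$ and $\kappa>0$ such that $\operatorname{dist}(x,\Phi^{-1}(y))\le\kappa\operatorname{dist}(y,\Phi(x))$ for all $x\in U$, $y\in V$, where $\Phi^{-1}(y):=\{x\mid y\in\Phi(x)\}$ (Euclidean distances, distance to the empty set being $+\infty$). Normal cones: for a set $A\subset\mathbb{R}^d$ and $\bar a\in A$, the tangent (Bouligand) cone is $\mathcal{T}_A(\bar a):=\{d\mid \exists t_k\searrow 0,\ d_k\to d\colon \bar a+t_kd_k\in A\ \forall k\}$, the regular normal cone is its polar $\widehat{\mathcal{N}}_A(\bar a):=\{v\mid v^\top d\le 0\ \forall d\in\mathcal{T}_A(\bar a)\}$, and the limiting normal cone is $\mathcal{N}_A(\bar a):=\{v\mid\exists a_k\to\bar a,\ a_k\in A,\ v_k\to v,\ v_k\in\widehat{\mathcal{N}}_A(a_k)\ \forall k\}$. All these sets are empty at points outside $A$. Limiting coderivative: $D^*\Phi(x,y)(y^* ):=\{x^*\in\mathbb{R}^n\mid (x^*,-y^* )\in\mathcal{N}_{\operatorname{gph}\Phi}(x,y)\}$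 for $y^*\in\mathbb{R}^m$ (empty if $(x,y)\notin\operatorname{gph}\Phi$). AM-regularity: let $\mathcal{M}(x,y):=\bigcup_{\lambda\in\mathbb{R}^m}D^*\Phi(x,y)(\lambda)\subset\mathbb{R}^n$. A point $\bar x\in M$ is AM-regular if $\limsup_{x\to\bar x,\,y\to0}\mathcal{M}(x,y)\subset\mathcal{M}(\bar x,0)$, where the left-hand side is the set of all $x^*\in\mathbb{R}^n$ for which there are sequences $x_k\to\bar x$, $y_k\to0$, $x_k^*\to x^*$ with $x_k^*\in\mathcal{M}(x_k,y_k)$ for all $k\in\mathbb{N}$. *)

(* Defs.v *)
From mathcomp Require Import all_boot all_order all_algebra.
From mathcomp Require Import all_classical all_reals all_analysis.
Set Implicit Arguments.
Unset Strict Implicit.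
Unset Printing Implicit Defensive.
Import Order.TTheory GRing.Theory Num.Theory.
Import numFieldNormedType.Exports.
Local Open Scope classical_set_scope.
Local Open Scope ring_scope.

(* R^d is 'rV[R]_d and R^n x R^m is 'rV[R]_(n + m), via row_mx.  Limits,
   neighborhoods and closedness refer to the library topology of 'rV[R]_d,
   which is the Euclidean one.  The library norm on matrices is the sup norm,
   hence the explicit Euclidean norm below. *)

Definition dot (R : realType) (d : nat) (u v : 'rV[R]_d) : R :=
  \sum_(i < d) u 0 i * v 0 i.

Definition enorm (R : realType) (d : nat) (u : 'rV[R]_d) : R :=
  Num.sqrt (dot u u).

(* Extended-real valued: ereal_inf set0 = +oo. *)
Definition dist (R : realType) (d : nat) (x : 'rV[R]_d) (A : set 'rV[R]_d) :
    \bar R :=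
  ereal_inf [set (enorm (x - z))%:E | z in A].

Definition tangent_cone (R : realType) (d : nat) (A : set 'rV[R]_d)
    (a : 'rV[R]_d) : set 'rV[R]_d :=
  [set v | A a /\ exists (t : nat -> R) (w : nat -> 'rV[R]_d),
    [/\ forall k, 0 < t k, t @ \oo --> (0 : R), w @ \oo --> v &
        forall k, A (a + t k *: w k)]].

(* The conjunct A a is needed: outside A the tangent cone is empty and its
   polar would be the whole space. *)
Definition regular_normal_cone (R : realType) (d : nat) (A : set 'rV[R]_d)
    (a : 'rV[R]_d) : set 'rV[R]_d :=
  [set v | A a /\ forall w, tangent_cone A a w -> dot v w <= 0].

Definition limiting_normal_cone (R : realType) (d : nat) (A : set 'rV[R]_d)
    (a : 'rV[R]_d) : set 'rV[R]_d :=
  [set v | A a /\ exists (ak vk : nat -> 'rV[R]_d),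
    [/\ ak @ \oo --> a, forall k, A (ak k), vk @ \oo --> v &
        forall k, regular_normal_cone A (ak k) (vk k)]].

Definition gph (R : realType) (n m : nat) (Phi : 'rV[R]_n -> set 'rV[R]_m) :
    set 'rV[R]_(n + m) :=
  [set row_mx p.1 p.2 | p in [set p : 'rV[R]_n * 'rV[R]_m | Phi p.1 p.2]].

Definition setinv (R : realType) (n m : nat) (Phi : 'rV[R]_n -> set 'rV[R]_m)
    (y : 'rV[R]_m) : set 'rV[R]_n :=
  [set x | Phi x y].

Definition metrically_regular (R : realType) (n m : nat)
    (Phi : 'rV[R]_n -> set 'rV[R]_m) (xb : 'rV[R]_n) (yb : 'rV[R]_m) : Prop :=
  gph Phi (row_mx xb yb) /\
  exists (U : set 'rV[R]_n) (V : set 'rV[R]_m) (kappa : R),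
    [/\ nbhs xb U, nbhs yb V, 0 < kappa &
        forall x y, U x -> V y ->
          (dist x (setinv Phi y) <= kappa%:E * dist y (Phi x))%E].

Definition coderivative (R : realType) (n m : nat)
    (Phi : 'rV[R]_n -> set 'rV[R]_m) (x : 'rV[R]_n) (y ys : 'rV[R]_m) :
    set 'rV[R]_n :=
  [set xs | limiting_normal_cone (gph Phi) (row_mx x y) (row_mx xs (- ys))].

Definition calM (R : realType) (n m : nat) (Phi : 'rV[R]_n -> set 'rV[R]_m)
    (x : 'rV[R]_n) (y : 'rV[R]_m) : set 'rV[R]_n :=
  \bigcup_(lambda in [set: 'rV[R]_m]) coderivative Phi x y lambda.

Definition outer_limit_calM (R : realType) (n m : nat)
    (Phi : 'rV[R]_n -> set 'rV[R]_m) (xb : 'rV[R]_n) (yb : 'rV[R]_m) :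
    set 'rV[R]_n :=
  [set xs | exists (xk : nat -> 'rV[R]_n) (yk : nat -> 'rV[R]_m)
                   (xsk : nat -> 'rV[R]_n),
    [/\ xk @ \oo --> xb, yk @ \oo --> yb, xsk @ \oo --> xs &
        forall k, calM Phi (xk k) (yk k) (xsk k)]].

Definition AM_regular (R : realType) (n m : nat)
    (Phi : 'rV[R]_n -> set 'rV[R]_m) (xb : 'rV[R]_n) : Prop :=
  outer_limit_calM Phi xb 0 `<=` calM Phi xb 0.

(* Main.v *)
(* Testing a regular normal (xs, -l) of gph Phi at (x, y) against a tangent
   direction (u, -l), which metric regularity provides with
   |u| <= kappa' |l|, bounds |l| by a multiple of |xs|, uniformly near (xb, 0).
   Given sequences defining an element xs of the outer limit, replace each
   limiting normal by a nearby regular one, at distance less than 1/(k+1): the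
   multipliers are eventually bounded, hence converge along a subsequence, and
   the limit exhibits xs as an element of calM Phi xb 0. *)

Require Import Defs.
From mathcomp Require Import all_boot all_order all_algebra.
From mathcomp Require Import all_classical all_reals all_analysis.
Import Order.TTheory GRing.Theory Num.Theory.
Import numFieldNormedType.Exports.
Local Open Scope classical_set_scope.
Local Open Scope ring_scope.

Section MetricRegularity.
Context {R : realType}.

Lemma norm_coord_le {d} (u : 'rV[R]_d) i : `|u 0 i| <= `|u|.
Proof.
rewrite [leRHS]/Num.norm /= mx_normrE.
exact: (le_bigmax _ (fun ij => `|u ij.1 ij.2|) (0, i)).
Qed.

Lemma norm_rV_le {d} (u : 'rV[R]_d) (M : R) :
  0 <= M -> (forall i, `|u 0 i| <= M) -> `|u| <= M.
Proof.
move=> M0 uM; rewrite [leLHS]/Num.norm /= mx_normrE.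
by apply: bigmax_le => // -[i j] _ /=; rewrite ord1.
Qed.

Lemma norm_row_mx {n m} (u : 'rV[R]_n) (v : 'rV[R]_m) :
  `|row_mx u v| = Num.max `|u| `|v|.
Proof.
apply/eqP; rewrite eq_le; apply/andP; split.
  apply: norm_rV_le => [|i]; first by rewrite le_max normr_ge0.
  by rewrite mxE; case: splitP => j _; rewrite le_max norm_coord_le ?orbT.
rewrite ge_max; apply/andP; split; apply: norm_rV_le => // i.
  by rewrite -(row_mxEl u v); exact: norm_coord_le.
by rewrite -(row_mxEr u v); exact: norm_coord_le.
Qed.

Lemma norm_lsubmx {n m} (w : 'rV[R]_(n + m)) : `|lsubmx w| <= `|w|.
Proof. by rewrite -{2}(hsubmxK w) norm_row_mx le_max lexx. Qed.

Lemma norm_rsubmx {n m} (w : 'rV[R]_(n + m)) : `|rsubmx w| <= `|w|.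
Proof. by rewrite -{2}(hsubmxK w) norm_row_mx le_max lexx orbT. Qed.

Lemma cvg_row_mx {n m} (u : nat -> 'rV[R]_n) (v : nat -> 'rV[R]_m)
    (a : 'rV[R]_n) (b : 'rV[R]_m) :
  u @ \oo --> a -> v @ \oo --> b ->
  (fun k => row_mx (u k) (v k)) @ \oo --> row_mx a b.
Proof.
move=> /cvgrPdist_lt ua /cvgrPdist_lt vb; apply/cvgrPdist_lt => e e0.
near=> k; rewrite opp_row_mx add_row_mx norm_row_mx gt_max.
by apply/andP; split; near: k; [exact: ua | exact: vb].
Unshelve. all: by end_near. Qed.

Lemma cvg_lsubmx {n m} (w : nat -> 'rV[R]_(n + m))
    (a : 'rV[R]_(n + m)) :
  w @ \oo --> a -> (fun k => lsubmx (w k)) @ \oo --> lsubmx a.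
Proof.
move=> /cvgrPdist_lt wa; apply/cvgrPdist_lt => e e0.
near=> k; rewrite -linearB/=; apply: le_lt_trans (norm_lsubmx _) _.
by near: k; exact: wa.
Unshelve. all: by end_near. Qed.

Lemma cvg_rsubmx {n m} (w : nat -> 'rV[R]_(n + m))
    (a : 'rV[R]_(n + m)) :
  w @ \oo --> a -> (fun k => rsubmx (w k)) @ \oo --> rsubmx a.
Proof.
move=> /cvgrPdist_lt wa; apply/cvgrPdist_lt => e e0.
near=> k; rewrite -linearB/=; apply: le_lt_trans (norm_rsubmx _) _.
by near: k; exact: wa.
Unshelve. all: by end_near. Qed.

(** Serves two purposes: a limit passes to a sequence of perturbations, and, with [a] constant, the
    rate 1/(k+1) itself yields convergence. *)
Lemma cvg_harmonic_dist {V : normedModType R} (a b : nat -> V) (l : V) :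
  (forall k, `|a k - b k| < k.+1%:R^-1) -> a @ \oo --> l -> b @ \oo --> l.
Proof.
move=> ab al.
rewrite -[l]subr0 (_ : b = a \- (a \- b)); last first.
  by apply/funext => k /=; rewrite subKr.
apply: cvgB => //; apply/norm_cvg0P.
apply: (@squeeze_cvgr _ _ _ _ (cst 0) harmonic).
- by near=> k; rewrite /= normr_ge0 ltW.
- exact: cvg_cst.
- exact: cvg_harmonic.
Unshelve. all: by end_near. Qed.

(* [phi] need not be increasing: [k <= phi k] is enough for [u \o phi] to
   inherit the limits of [u]. *)
Lemma cvg_comp_geid {T : topologicalType} (phi : nat -> nat) (u : nat -> T)
    (l : T) :
  (forall k, (k <= phi k)%N) -> u @ \oo --> l -> (u \o phi) @ \oo --> l.
Proof.
move=> phi_ge; apply: cvg_comp => A [N _ NA]; exists N => // k /= Nk.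
exact/NA/(leq_trans Nk).
Qed.

(** The closed ball is compact, so [u] has a cluster point [l] in it; [phi k] is any index beyond
    [k] at which [u] is within 1/(k+1) of [l]. *)
Lemma bounded_subseq {d} (u : nat -> 'rV[R]_d) (M : R) :
  (forall k, `|u k| <= M) ->
  exists (phi : nat -> nat) (l : 'rV[R]_d),
    [/\ forall k, (k <= phi k)%N, (u \o phi) @ \oo --> l & `|l| <= M].
Proof.
move=> uM; pose B := [set v : 'rV[R]_d | `|v| <= M].
have cB : compact B.
  apply: bounded_closed_compact.
    by exists M; split; [exact: num_real|move=> N /ltW MN v /le_trans; apply].
  apply: (@preimage_closed _ _ (fun v : 'rV[R]_d => `|v|) [set r | r <= M]).
    by move=> v _; exact: norm_continuous.
  exact: closed_le.
have uB : (u @ \oo) B by exists 0%N => // k _; exact: uM.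
have [l [Bl cl]] := cB (u @ \oo) _ uB.
have /choice[phi phiP] k : exists j, (k <= j)%N /\ `|l - u j| < k.+1%:R^-1.
  have [v [[j kj <-] lv]] : [set u j | j in [set j | (k <= j)%N]] `&`
      ball l (k.+1%:R^-1 : R) !=set0.
    apply: cl; last by apply: nbhsx_ballx; rewrite invr_gt0.
    by exists k => // j /= kj; exists j.
  by exists j; split => //; move: lv; rewrite -ball_normE.
exists phi, l; split => //; first by move=> k; case: (phiP k).
apply: (@cvg_harmonic_dist _ (cst l)); last exact: cvg_cst.
by move=> k; case: (phiP k).
Qed.

Lemma dot_row_mx {n m} (a c : 'rV[R]_n) (b e : 'rV[R]_m) :
  dot (row_mx a b) (row_mx c e) = dot a c + dot b e.
Proof.
rewrite /dot big_split_ord/=; congr (_ + _); apply: eq_bigr => i _.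
  by rewrite !row_mxEl.
by rewrite !row_mxEr.
Qed.

Lemma dotNN {d} (u v : 'rV[R]_d) : dot (- u) (- v) = dot u v.
Proof. by apply: eq_bigr => i _; rewrite !mxE mulrNN. Qed.

Lemma dot_self_ge0 {d} (u : 'rV[R]_d) : 0 <= dot u u.
Proof. by apply: sumr_ge0 => i _; rewrite -expr2 sqr_ge0. Qed.

(** A crude substitute for Cauchy-Schwarz in the sup norm; the dimension factor is harmless, since
    only boundedness of multipliers is sought. *)
Lemma norm_dot_le {d} (u v : 'rV[R]_d) : `|dot u v| <= d%:R * (`|u| * `|v|).
Proof.
rewrite (le_trans (ler_norm_sum _ _ _))//.
rewrite -[X in X%:R]card_ord mulr_natl -sumr_const ler_sum// => i _.
by rewrite normrM ler_pM// norm_coord_le.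
Qed.

Lemma sqr_enorm {d} (u : 'rV[R]_d) : enorm u ^+ 2 = dot u u.
Proof. by rewrite sqr_sqrtr// dot_self_ge0. Qed.

Lemma enorm_ge0 {d} (u : 'rV[R]_d) : 0 <= enorm u.
Proof. exact: sqrtr_ge0. Qed.

Lemma norm_le_enorm {d} (u : 'rV[R]_d) : `|u| <= enorm u.
Proof.
apply: norm_rV_le => [|i]; first exact: enorm_ge0.
rewrite -sqrtr_sqr ler_sqrt ?dot_self_ge0// /dot (bigD1 i)//= expr2 lerDl.
by apply: sumr_ge0 => j _; rewrite -expr2 sqr_ge0.
Qed.

Lemma enormZ {d} (t : R) (u : 'rV[R]_d) : enorm (t *: u) = `|t| * enorm u.
Proof.
have -> : enorm (t *: u) = Num.sqrt (t ^+ 2 * dot u u).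
  congr Num.sqrt; rewrite [RHS]mulr_sumr; apply: eq_bigr => i _.
  by rewrite !mxE mulrACA expr2.
by rewrite sqrtrM ?sqr_ge0// sqrtr_sqr.
Qed.

Lemma gph_row_mx {n m} (Phi : 'rV[R]_n -> set 'rV[R]_m) x y :
  gph Phi (row_mx x y) = Phi x y.
Proof.
apply/propext; split => [[[a b] /= Pab /eq_row_mx[<- <-]]//|Pxy].
by exists (x, y).
Qed.

(** Here [x] is fixed and only [y'] varies. The slack between [kappa] and [kappa'] is there because
    the infimum in [dist] need not be attained; the factor [n] comes from [norm_dot_le]. *)
Lemma regular_coderivative_bound {n m} (Phi : 'rV[R]_n -> set 'rV[R]_m)
    (V : set 'rV[R]_m) (kappa kappa' : R) x y xs l :
  nbhs y V -> 0 <= kappa < kappa' ->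
  (forall y', V y' ->
    (dist x (setinv Phi y') <= kappa%:E * dist y' (Phi x))%E) ->
  regular_normal_cone (gph Phi) (row_mx x y) (row_mx xs (- l)) ->
  enorm l <= n%:R * `|xs| * kappa'.
Proof.
move=> yV /andP[k0 kk'] reg [gxy normal].
have Pxy : Phi x y by rewrite -gph_row_mx.
have k'0 : 0 < kappa' by exact: le_lt_trans kk'.
(* A positive [enorm l] makes the distance estimate below strict and allows the final division by
   it. *)
have [l0|lpos] := leP (enorm l) 0.
  by rewrite (le_trans l0)// !mulr_ge0// ltW.
(* The pair is a step size [t] and the quotient [(z - x) / t], where [z] is a nearly closest point
   to [x] with [y - t l] in [Phi z]. *)
have step k : exists tu : R * 'rV[R]_n, [/\ 0 < tu.1, tu.1 < k.+1%:R^-1,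
    `|tu.2| <= kappa' * enorm l &
    gph Phi (row_mx x y + tu.1 *: row_mx tu.2 (- l))].
  have yl : (fun t : R => y + t *: - l) @ 0^'+ --> y.
    rewrite -[X in _ --> X]addr0; apply: cvgD; first exact: cvg_cst.
    rewrite -(scale0r (- l)); apply: cvgZr_tmp.
    exact: cvg_at_right_filter cvg_id.
  have [t [[t0 tk] Vt]] : exists t : R,
      (0 < t /\ t < k.+1%:R^-1) /\ V (y + t *: - l).
    apply: (@filter_ex _ (0^'+ : set_system R)).
    near=> t; split; [split|]; near: t.
    - exact: nbhs_right_gt.
    - by apply: nbhs_right_lt; rewrite invr_gt0.
    - exact: yl.
  (* Since [y] lies in [Phi x], the distance from [y - t l] to [Phi x] is at most [t * enorm l]. *)
  have : (dist x (setinv Phi (y + t *: - l)) < (kappa' * (t * enorm l))%:E)%E.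
    apply: le_lt_trans (reg _ Vt) _.
    apply: (@le_lt_trans _ _ (kappa * (t * enorm l))%:E).
      rewrite EFinM; apply: lee_wpmul2l; first by rewrite lee_fin.
      apply: ereal_inf_lbound; exists y => //.
      by rewrite addrC addKr enormZ gtr0_norm// /enorm dotNN.
    by rewrite lte_fin ltr_pM2r// mulr_gt0.
  move=> /ereal_inf_lt[_ [z Pz <-]]; rewrite lte_fin => xz.
  exists (t, t^-1 *: (z - x)); split => //=.
    rewrite normrZ gtr0_norm ?invr_gt0// ler_pdivrMl// distrC.
    by rewrite (le_trans (norm_le_enorm _))// mulrCA ltW.
  rewrite scale_row_mx scalerA divff ?gt_eqF// scale1r add_row_mx gph_row_mx.
  by rewrite addrC subrK.
have {step} /choice[tu tuP] := step.
have [|phi [u [phi_ge u_cvg u_le]]] :=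
  @bounded_subseq _ (fun k => (tu k).2) (kappa' * enorm l).
  by move=> k; case: (tuP k).
have /normal : tangent_cone (gph Phi) (row_mx x y) (row_mx u (- l)).
  split => //; exists (fun k => (tu (phi k)).1).
  exists (fun k => row_mx (tu (phi k)).2 (- l)); split.
  - by move=> k; case: (tuP (phi k)).
  - apply: (@cvg_comp_geid _ phi (fun k => (tu k).1)) => //.
    apply: (@cvg_harmonic_dist _ (cst 0)); last exact: cvg_cst.
    by move=> k; case: (tuP k) => t0 tk _ _; rewrite sub0r normrN gtr0_norm.
  - by apply: cvg_row_mx => //; exact: cvg_cst.
  - by move=> k; case: (tuP (phi k)).
(* Polarity reads [dot xs u + enorm l ^+ 2 <= 0], so [enorm l ^+ 2] is at most [n * |xs| * |u|],
   with [|u| <= kappa' * enorm l]. *)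
rewrite dot_row_mx dotNN -sqr_enorm -lerBrDl sub0r => llexs.
rewrite -(ler_pM2r lpos) -expr2 (le_trans llexs)//.
rewrite (le_trans (ler_norm _))// normrN (le_trans (norm_dot_le _ _))//.
by rewrite -!mulrA !ler_wpM2l.
Unshelve. all: by end_near. Qed.

End MetricRegularity.

Theorem theorem3p12 (R : realType) (n m : nat)
    (Phi : 'rV[R]_n -> set 'rV[R]_m) (xb : 'rV[R]_n)
    (closed_gph : closed (gph Phi))
    (xb_feasible : xb \in setinv Phi 0)
    (metric_reg : metrically_regular Phi xb 0) :
  AM_regular Phi xb.
Proof.
have [gxb [U [V [kappa [Uxb V0 k0 reg]]]]] := metric_reg.
move=> xs [xk [yk [xsk [xk_cvg yk_cvg xsk_cvg calMk]]]].
(* [p] holds a graph point and a regular normal there. Only the first block of the normal is kept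
   close to given data; the second is controlled afterwards by the uniform bound. *)
have step k : exists p : 'rV[R]_(n + m) * 'rV[R]_(n + m),
    [/\ `|row_mx (xk k) (yk k) - p.1| < k.+1%:R^-1,
        `|xsk k - lsubmx p.2| < k.+1%:R^-1 &
        regular_normal_cone (gph Phi) p.1 p.2].
  have [l _ [_ [a [v [a_cvg _ v_cvg av]]]]] := calMk k.
  have e0 : 0 < k.+1%:R^-1 :> R by rewrite invr_gt0.
  have v1_cvg := cvg_lsubmx _ _ v_cvg; rewrite row_mxKl in v1_cvg.
  near \oo => j; exists (a j, v j); split => //=; near: j.
    exact: (cvgrPdist_lt _ _).1 a_cvg _ e0.
  exact: (cvgrPdist_lt _ _).1 v1_cvg _ e0.
have {step} /choice[p pP] := step.
have p1_cvg : (fun k => (p k).1) @ \oo --> row_mx xb (0 : 'rV[R]_m).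
  apply: (cvg_harmonic_dist (fun k => row_mx (xk k) (yk k))).
    by move=> k; case: (pP k).
  exact: cvg_row_mx.
have p2_cvg : (fun k => lsubmx (p k).2) @ \oo --> xs.
  by apply: (cvg_harmonic_dist xsk) => // k; case: (pP k).
(* [|xs| + 1] eventually dominates the first blocks, and [kappa + 1] plays the role of [kappa']. *)
pose M := n%:R * (`|xs| + 1) * (kappa + 1).
have [N _ bound] : \forall k \near \oo, `|rsubmx (p k).2| <= M.
  near=> k.
  have Uk : U (lsubmx (p k).1).
    near: k; have := cvg_lsubmx _ _ p1_cvg.
    by rewrite row_mxKl => /(_ _ Uxb).
  (* Membership in [V] would not suffice: the bound moves [y] to [y - t l] inside [V]. Hence the
     interior of [V]. *)
  have Vk : nbhs (rsubmx (p k).1) V.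
    near: k; have := cvg_rsubmx _ _ p1_cvg.
    by rewrite row_mxKr => /(_ _ (nbhs_interior V0)).
  have xs1 : `|lsubmx (p k).2| <= `|xs| + 1.
    by near: k; apply: cvgr_norm_le p2_cvg _ _; rewrite ltrDl.
  have normal : regular_normal_cone (gph Phi)
      (row_mx (lsubmx (p k).1) (rsubmx (p k).1))
      (row_mx (lsubmx (p k).2) (- - rsubmx (p k).2)).
    by rewrite opprK !hsubmxK; case: (pP k).
  have kk : 0 <= kappa < kappa + 1 by rewrite ltW//= ltrDl.
  have := regular_coderivative_bound _ _ _ _ _ _ _ _ Vk kk
    (fun y' => reg _ y' Uk) normal.
  move=> /(le_trans (norm_le_enorm _)); rewrite normrN => /le_trans; apply.
  by rewrite ler_wpM2r ?ler_wpM2l// addr_ge0// ltW.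
(* The shift by [N] makes the eventual bound hold at every index. *)
have [|phi [v [phi_ge v_cvg _]]] :=
  bounded_subseq (fun k => rsubmx (p (k + N)%N).2) M.
  by move=> k; apply: bound; rewrite /= leq_addl.
have phiN_ge k : (k <= phi k + N)%N.
  by rewrite (leq_trans (phi_ge k))// leq_addr.
(* [v] is the limit of the second blocks, which the coderivative takes with the opposite sign. *)
exists (- v) => //; split => //.
exists (fun k => (p (phi k + N)%N).1), (fun k => (p (phi k + N)%N).2); split.
- exact: (cvg_comp_geid _ _ _ phiN_ge p1_cvg).
- by move=> k; case: (pP (phi k + N)%N) => _ _ [].
- rewrite opprK.
  rewrite (_ : (fun k => _) = fun k =>
    row_mx (lsubmx (p (phi k + N)%N).2) (rsubmx (p (phi k + N)%N).2)).
    by apply: cvg_row_mx => //; exact: (cvg_comp_geid _ _ _ phiN_ge p2_cvg).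
  by apply/funext => k; rewrite hsubmxK.
- by move=> k; case: (pP (phi k + N)%N).
Unshelve. all: by end_near. Qed.
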